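(* Let $k=2^n+m-1\geq 2$, where $n$ is a positive integer and $m$ is a nonnegative integer with $m<2^n$. If $G$ is a graph with minimum degree $\delta\geq \frac{3}{2}k^2+\frac{1}{2}km+\frac{1}{2}k$, then $G$ has a $\frac{1}{k}$-majority $(k+1)$-edge-colouring.
   Context: Graphs are finite and simple. For an integer $k\geq 2$, a $\frac{1}{k}$-majority $l$-edge-colouring of a graph $G$ is an assignment to each edge of $G$ of one of $l$ colours such that for every colour $i$ and every vertex $v$ of $G$, at most $\frac{d_G(v)}{k}$ of the edges incident with $v$ have colour $i$ (where $d_G(v)$ is the degree of $v$). *)

(* Defs.v *)
From mathcomp Require Import all_boot all_order all_algebra.

Set Implicit Arguments.
Unset Strict Implicit.
Unset Printing Implicit Defensive.

Import GRing.Theory Num.Theory.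

Record sgraph : Type := SGraph {
  vertex :> finType;
  adj : rel vertex;
  adj_sym : symmetric adj;
  adj_irrefl : irreflexive adj
}.

Section GraphNotions.
Variable G : sgraph.

Definition degree (v : G) : nat := #|[set w : G | adj v w]|.

(* Every degree is less than #|G|, so for a graph with a vertex the initial
   value of the iterated minimum plays no role; on the null graph the result
   is 0. *)
Definition min_degree : nat := \big[minn/#|G|]_(v : G) degree v.

Definition edges : {set {set G}} :=
  [set [set p.1; p.2] | p : G * G & adj p.1 p.2].

Definition edge : Type := {f : {set G} | f \in edges}.

Definition colour_degree (l : nat) (c : edge -> 'I_l) (v : G) (i : 'I_l) : nat :=
  #|[set f : edge | (v \in sval f) && (c f == i)]|.

Definition majority_edge_colouring (k l : nat) (c : edge -> 'I_l) : Prop :=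
  forall (i : 'I_l) (v : G),
    ((colour_degree c v i)%:R <= (degree v)%:R / k%:R :> rat)%R.

End GraphNotions.

Arguments majority_edge_colouring : clear implicits.

(* Main.v *)
Require Import Defs.
From mathcomp Require Import all_boot all_order all_algebra all_fingroup.
From mathcomp Require Import zify ring lra.

(** Write [d_i(v)] for the number of edges of colour [i] at [v], [d(v)] for the
    degree and [q(v)] for the integer part of [d(v) / k].  Among all
    [(k+1)]-colourings minimise the energy [sum d_i(v)^2], and then the number
    of pairs [(v, i)] with [d_i(v) > q(v)].

    Swapping [i] and [j] along a maximal alternating trail lowers the energy
    if [d_i(v) >= d_j(v) + 3], so the colour degrees at a vertex differ by at
    most 2.  If [d_i(v) > q(v)], then [d_i(v) = q(v) + 1], and the set [S] of
    colours [j] with [d_j(v) = d_i(v) - 2] has at least [q(v) + 2 - k]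
    elements.  Let [vu] be an edge of colour [i].  Recolouring it with [j] in
    [S] keeps the energy minimal, so by the second minimality it must make [u]
    exceed [q(u)]: thus [d_i(u) = d_j(u) = q(u)] for all [j] in [S], while all
    other colour degrees at [u] are at least [q(u) - 1].  Summing up the colour
    degrees at [u] gives [q(u) + q(v) <= 3k - 3], but the degree hypothesis
    forces [2 q >= 3k]. *)

Set Implicit Arguments.
Unset Strict Implicit.
Unset Printing Implicit Defensive.

Import Order.TTheory GRing.Theory Num.Theory.

(** * Colour swaps, energy and alternating trails in a loopless multigraph *)

Section Multigraph.

Variables (V E C : finType) (inc : V -> E -> bool).
Hypothesis inc_ends : forall e x, inc x e ->
  exists2 y, y != x & forall z, inc z e = (z == x) || (z == y).

Implicit Types (c : {ffun E -> C}) (v u x w : V) (i j l : C) (T F : {set E}).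

Definition cdeg c v i : nat := #|[set e | inc v e && (c e == i)]|.

Definition energy c : nat := \sum_v \sum_i cdeg c v i ^ 2.

Definition swap c T i j : {ffun E -> C} :=
  [ffun e => if e \in T then tperm i j (c e) else c e].

Local Open Scope ring_scope.

Definition colour_sign i j i' : int := (i' == i)%:R - (i' == j)%:R.

(** A signed degree: [i]-edges of [T] at [v] minus [j]-edges. For [i != j], the swap along [T] moves
    this many edges at [v] from [i] to [j]. *)
Definition net c T i j v : int :=
  \sum_(e in T) (inc v e)%:R * colour_sign i j (c e).

Lemma cdegE c v i : (cdeg c v i)%:R = \sum_e (inc v e && (c e == i))%:R :> int.
Proof.
rewrite /cdeg -sum1_card natr_sum [LHS]big_mkcond /=.
by apply: eq_bigr => e _; rewrite inE; case: ifP.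
Qed.

Lemma cdeg_swap c T i j v l : i != j ->
  (cdeg (swap c T i j) v l)%:R
    = (cdeg c v l)%:R - net c T i j v * colour_sign i j l :> int.
Proof.
move=> neq_ij; rewrite !cdegE /net [X in _ - X * _]big_mkcond mulr_suml -sumrB.
apply: eq_bigr => e _; rewrite ffunE; case: (e \in T); last by rewrite mul0r subr0.
case: (inc v e); rewrite /= ?mul0r ?subr0 // mul1r /colour_sign.
have neq_ji : j != i by rewrite eq_sym.
case: tpermP => [->|->|/eqP/negbTE ni /eqP/negbTE nj].
- rewrite eqxx (negbTE neq_ij) !(eq_sym _ l).
  by case: eqVneq => [->|_]; rewrite ?(negbTE neq_ij) //; case: eqVneq.
- rewrite eqxx (negbTE neq_ji) !(eq_sym _ l).
  by case: eqVneq => [->|_]; rewrite ?(negbTE neq_ij) //; case: eqVneq.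
- by rewrite ni nj subr0 mul0r subr0.
Qed.

(** At each vertex only [i] and [j] matter, and [(a - t)^2 + (b + t)^2 = a^2 + b^2 + 2t(t - (a -
    b))]. *)
Lemma energy_swap c T i j : i != j ->
  (energy (swap c T i j))%:R = (energy c)%:R
    + \sum_v 2 * net c T i j v
        * (net c T i j v - ((cdeg c v i)%:R - (cdeg c v j)%:R)) :> int.
Proof.
move=> neq_ij; rewrite /energy !natr_sum -big_split; apply: eq_bigr => v _.
have neq_ji : j != i by rewrite eq_sym.
rewrite !natr_sum (bigD1 i) //= (bigD1 j) //= [in RHS](bigD1 i) //=.
rewrite [in RHS](bigD1 j) //= !natrX !cdeg_swap // /colour_sign !eqxx.
rewrite (negbTE neq_ij) (negbTE neq_ji).
set A := \sum_(_ | _) _; set A' := \sum_(_ | _) _; have -> : A = A'.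
  apply: eq_bigr => l /andP[/negbTE li /negbTE lj].
  by rewrite !natrX cdeg_swap // /colour_sign li lj subr0 mulr0 subr0.
rewrite /=; ring.
Qed.

(* Greedily extend an alternating trail from [x] (next sign [b]) inside [F]
   until it gets stuck at [w] for lack of unused edges of sign [b']. *)
Lemma maximal_alternating_trail (sg : E -> int) F x (b : int) :
    b = 1 \/ b = -1 ->
  exists T w (b' : int), [/\ T \subset F, b' = 1 \/ b' = -1,
    forall z, \sum_(e in T) (inc z e)%:R * sg e
                = b * (z == x)%:R - b' * (z == w)%:R
    & forall e, e \in F :\: T -> inc w e -> sg e != b'].
Proof.
have [n] := ubnP #|F|; elim: n F x b => // n IHn F x b leFn b1.
case: (pickP [pred e in F | inc x e && (sg e == b)]) => [e|stuck]; last first.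
  exists set0, x, b; split=> //; [exact: sub0set|move=> z|move=> e].
    by rewrite big_set0 subrr.
  by rewrite setD0 => Fe xe; have := stuck e; rewrite /= Fe xe /= => ->.
case/and3P=> Fe xe /eqP sge; have [y neq_yx incE] := inc_ends xe.
have ltF : (#|F :\ e| < n)%N by rewrite (cardsD1 e) Fe in leFn.
have b1' : - b = 1 \/ - b = -1 by case: b1 => ->; rewrite ?opprK; [right|left].
have [T [w [b' [sTF b'1 sumT stuckT]]]] := IHn _ y (- b) ltF b1'.
have eT : e \notin T by apply/negP => /(subsetP sTF); rewrite !inE eqxx.
exists (e |: T), w, b'; split=> //.
- by rewrite subUset sub1set Fe (subset_trans sTF) // subD1set.
- move=> z; rewrite big_setU1 //= sumT sge incE.
  have [->|_] := eqVneq z x; last by rewrite /=; ring.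
  by rewrite eq_sym (negbTE neq_yx) /=; ring.
- move=> f; rewrite !inE negb_or -andbA => /and3P[nfe nfT Ff].
  by apply: stuckT; rewrite !inE nfe nfT Ff.
Qed.

(** Swap along a maximal trail leaving [v] by colour [i]. If it ends at [w != v], then [v] saves
    exactly the claimed amount, inner vertices are unaffected, and being stuck prevents a loss at
    [w]. *)
Lemma energy_descent c v i j :
  (cdeg c v j + 3 <= cdeg c v i)%N ->
  exists c', (energy c' + (cdeg c v i - cdeg c v j - 1) * 2 <= energy c)%N.
Proof.
move=> gap; have neq_ij : i != j by apply: contraTneq gap => ->; lia.
have [T [w [b' [_ b'1 sumT stuck]]]] :=
  maximal_alternating_trail (fun e => colour_sign i j (c e)) setT v (or_introl erefl).
exists (swap c T i j).
(* Edges at [w] outside [T] never have sign [b'], so they add at most 0 to the left side. *)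
have Dle z : b' * ((cdeg c z i)%:R - (cdeg c z j)%:R) <= b' * net c T i j z
    \/ z != w.
  have [->|] := eqVneq z w; last by right.
  left; rewrite !cdegE -sumrB mulr_sumr /net mulr_sumr [leRHS]big_mkcond /=.
  apply: ler_sum => e _; case: ifPn => eT.
    by rewrite /colour_sign; case: (inc w e); rewrite /= ?mul1r // mul0r subrr mulr0.
  have := stuck e; rewrite !inE eT => /(_ isT).
  case: (inc w e) => [/(_ isT)|_]; last by rewrite subrr mulr0.
  rewrite /colour_sign /=.
  by case: (c e == i); case: (c e == j); case: b'1 => ->.
have := energy_swap c T neq_ij; rewrite (bigD1 v) //=.
have netE z : net c T i j z = (z == v)%:R - b' * (z == w)%:R.
  by rewrite /net sumT mul1r.
set rest := \sum_(_ | _) _; have rest0 : rest <= 0.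
  apply: sumr_le0 => z /negbTE nzv.
  move: (Dle z); rewrite netE nzv sub0r.
  case: (eqVneq z w) => [_ [|//]|_ _]; last by rewrite mulr0 oppr0 mulr0 mul0r.
  by rewrite /= mulr1; case: b'1 => ->; lia.
move: (Dle v); rewrite netE eqxx.
(* Put [D = d_i(v) - d_j(v)]. For a closed trail, [b' = 1] would force [D <= 0], and [b' = -1] saves
   [4(D - 2)], which is at least [2(D - 1)] because [D >= 3]. *)
case: (eqVneq v w) => _; case: b'1 => -> /= [] // H; lia.
Qed.

(** * Recolouring a single edge *)

Lemma net_edge c e i j v : c e = i -> i != j ->
  net c [set e] i j v = (inc v e)%:R.
Proof.
move=> cei neq_ij; rewrite /net big_set1 /colour_sign cei eqxx (negbTE neq_ij).
by rewrite subr0 mulr1.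
Qed.

Lemma cdeg_recolour c e i j v l : c e = i -> i != j ->
  (cdeg (swap c [set e] i j) v l + inc v e * (l == i)
     = cdeg c v l + inc v e * (l == j))%N.
Proof.
move=> cei neq_ij; have := cdeg_swap c [set e] v l neq_ij.
rewrite net_edge // /colour_sign.
by case: (inc v e); case: (l == i); case: (l == j); lia.
Qed.

Lemma energy_recolour c e i j v u : c e = i -> i != j -> u != v ->
    (forall z, inc z e = (z == v) || (z == u)) ->
  (energy (swap c [set e] i j) + (cdeg c v i + cdeg c u i) * 2
     = energy c + (cdeg c v j + cdeg c u j) * 2 + 4)%N.
Proof.
move=> cei neq_ij neq_uv incE; have := energy_swap c [set e] neq_ij.
rewrite (bigD1 v) //= (bigD1 u) //= big1 => [|z /andP[/negbTE nv /negbTE nu]].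
  by rewrite !net_edge // !incE !eqxx orbT; lia.
by rewrite net_edge // incE nv nu mulr0 mul0r.
Qed.

Local Close Scope ring_scope.

Definition vdeg v := #|[set e | inc v e]|.

Lemma sum_cdeg c v : \sum_i cdeg c v i = vdeg v.
Proof.
rewrite /vdeg -sum1_card (partition_big c xpredT) //=; apply: eq_bigr => i _.
by rewrite /cdeg -sum1_card; apply: eq_bigl => e; rewrite !inE.
Qed.

(** * Colourings of minimum energy *)

Definition min_energy c := forall c', energy c <= energy c'.

Lemma cdeg_window c v i j : min_energy c -> cdeg c v i <= cdeg c v j + 2.
Proof.
move=> minc; rewrite leqNgt; apply/negP => gap.
have /energy_descent[c' lec'] : cdeg c v j + 3 <= cdeg c v i by lia.
by have := minc c'; lia.
Qed.

(* Recolouring [e] changes the energy by [2 (d_j(u) - d_i(u))]; if this is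
   positive, [u] gets a gap of at least 3, and the descent regains more. *)
Lemma min_energy_neighbour c e i j v u : min_energy c ->
    cdeg c v i = cdeg c v j + 2 -> c e = i -> u != v ->
    (forall z, inc z e = (z == v) || (z == u)) ->
  cdeg c u i = cdeg c u j /\ min_energy (swap c [set e] i j).
Proof.
move=> minc gap cei neq_uv incE.
have neq_ij : i != j by apply: contra_eq_neq gap => ->; lia.
have Een := energy_recolour cei neq_ij neq_uv incE.
have le1 := minc (swap c [set e] i j).
have eq_u : cdeg c u i = cdeg c u j.
  apply/eqP; rewrite eqn_leq; apply/andP; split; first by lia.
  rewrite leqNgt; apply/negP => ltu.
  have := cdeg_recolour u i cei neq_ij; have := cdeg_recolour u j cei neq_ij.
  rewrite incE !eqxx orbT (negbTE neq_ij) (eq_sym j) (negbTE neq_ij) => Dj Di.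
  have gap3 : cdeg (swap c [set e] i j) u i + 3 <= cdeg (swap c [set e] i j) u j.
    by lia.
  by have [c' lec'] := energy_descent gap3; have := minc c'; lia.
by split=> // c'; have := minc c'; lia.
Qed.

Lemma sum_mem (I : finType) (A : {pred I}) : \sum_l (l \in A : nat) = #|A|.
Proof. by rewrite -sum1_card [RHS]big_mkcond; apply: eq_bigr => l _; case: ifP. Qed.

Lemma sum_eq (I : finType) (i : I) : \sum_l (l == i : nat) = 1.
Proof. by rewrite -(card1 i) -sum_mem. Qed.

(** * The second minimisation and the bounded colouring *)

Definition excess (q : V -> nat) c := \sum_v \sum_i (q v < cdeg c v i : nat).

Lemma exists_lex_min_colouring (q : V -> nat) (i0 : C) :
  exists2 c, min_energy c &
    forall c', min_energy c' -> excess q c <= excess q c'.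
Proof.
pose c0 : {ffun E -> C} := [ffun=> i0].
case: (@arg_minnP _ c0 xpredT energy isT) => c1 _ min1.
case: (@arg_minnP _ c1 (fun c => energy c == energy c1) (excess q) (eqxx _)).
move=> c /eqP eqc minc; exists c => [c'|c' minc']; first by rewrite eqc min1.
by apply: minc; rewrite eqn_leq min1 // minc'.
Qed.

(** Giving [e] colour [j] removes the excess pair [(v, i)], and [d_j(v)] only rises to [q v]. By
    minimality a new pair must appear, and only [(u, j)] can, which requires [d_j(u) = q u]. *)
Lemma recolour_neighbour_full (q : V -> nat) c e i j v u : min_energy c ->
    (forall c', min_energy c' -> excess q c <= excess q c') ->
    cdeg c v i = (q v).+1 -> cdeg c v i = cdeg c v j + 2 ->
    c e = i -> u != v -> (forall z, inc z e = (z == v) || (z == u)) ->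
  cdeg c u i = q u /\ cdeg c u j = q u.
Proof.
move=> minc mine fullv gap cei neq_uv incE.
have [eq_u min1] := min_energy_neighbour minc gap cei neq_uv incE.
suff: cdeg c u i == q u by move/eqP=> <-.
apply/negPn/negP => neq_q; have := mine _ min1; apply/negP; rewrite -ltnNge.
have neq_ij : i != j by apply: contra_eq_neq gap => ->; lia.
have le_term z l :
    (q z < cdeg (swap c [set e] i j) z l) + (z == v) * (l == i)
      <= (q z < cdeg c z l).
  have := cdeg_recolour z l cei neq_ij; rewrite incE.
  have [->|_] := eqVneq z v; last have [->|_] := eqVneq z u;
    (have [->|_] := eqVneq l i; rewrite ?(negbTE neq_ij) //=;
     last have [->|_] := eqVneq l j);
    by lia.
have : \sum_z \sum_l ((q z < cdeg (swap c [set e] i j) z l) + (z == v) * (l == i))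
    <= excess q c.
  by apply: leq_sum => z _; apply: leq_sum => l _; apply: le_term.
under eq_bigr => z _ do rewrite big_split -big_distrr /= sum_eq muln1.
by rewrite big_split /= sum_eq /excess addn1.
Qed.

Lemma exists_bounded_colouring k : #|C| = k.+1 -> 0 < k ->
    (forall v, 3 * k <= 2 * (vdeg v %/ k)) ->
  exists c, forall v i, cdeg c v i <= vdeg v %/ k.
Proof.
move=> cardC k_gt0 large; pose q v := vdeg v %/ k.
have /card_gt0P[i0 _] : 0 < #|C| by rewrite cardC.
have [c minc mine] := exists_lex_min_colouring q i0.
exists c => v i; rewrite leqNgt; apply/negP; rewrite -/(q v) => bad.
have largeq z : 3 * k <= 2 * q z by apply: large.
have ltq z : vdeg z < (q z).+1 * k by apply: ltn_ceil.
have sumC (a : nat) : \sum_(l : C) a = k.+1 * a by rewrite sum_nat_const cardC.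
have fullv : cdeg c v i = (q v).+1.
  apply/eqP; rewrite eqn_leq bad andbT leqNgt; apply/negP => bad2.
  (* With [d_i(v) >= q v + 2] all colour degrees are at least [q v], so
     [vdeg v >= (k + 1) * q v + 2], too much as [q v >= k]. *)
  have : \sum_l (cdeg c v i + ((l == i) + (l == i))) <= \sum_l (cdeg c v l + 2).
    apply: leq_sum => l _; have := cdeg_window v i l minc.
    by have [->|] := eqVneq l i; lia.
  rewrite !big_split /= !sumC sum_cdeg !sum_eq.
  by have := ltq v; have := largeq v; nia.
pose S := [set l | cdeg c v i == cdeg c v l + 2].
have cardS : q v + 2 <= #|S| + k.
  (* Colour degrees at [v] are [q v - 1] on [S] and at least [q v] off [S]. *)
  have : \sum_l (q v + (l == i)) <= \sum_l (cdeg c v l + (l \in S)).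
    apply: leq_sum => l _; have := cdeg_window v i l minc; rewrite inE.
    by have [->|] := eqVneq l i; lia.
  rewrite !big_split /= sum_eq !sumC sum_cdeg sum_mem.
  by have := ltq v; have := largeq v; nia.
have /card_gt0P[e] : 0 < cdeg c v i by rewrite fullv.
rewrite inE => /andP[ve /eqP cei]; have [u neq_uv incE] := inc_ends ve.
have /card_gt0P[j jS] : 0 < #|S| by have := largeq v; lia.
have gap l : l \in S -> cdeg c v i = cdeg c v l + 2 by rewrite inE => /eqP.
have fullu l : l \in S -> cdeg c u i = q u /\ cdeg c u l = q u.
  by move=> /gap lS; apply: (recolour_neighbour_full minc mine fullv lS cei).
have [_ min1] := min_energy_neighbour minc (gap j jS) cei neq_uv incE.
have neq_ij : i != j by apply: contra_eq_neq (gap j jS) => ->; lia.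
(* After recolouring [e] with [j], [u] has [q u + 1] edges of colour [j], and the window of width 2
   applies to this new minimum. *)
have lowu l : q u <= cdeg c u l + 1.
  have := cdeg_window u j l min1.
  have := cdeg_recolour u j cei neq_ij; have := cdeg_recolour u l cei neq_ij.
  rewrite incE !eqxx orbT (eq_sym j) (negbTE neq_ij).
  have [_ ->] := fullu j jS; have [->|_] := eqVneq l j; first by lia.
  by case: (l == i); lia.
have : \sum_l (q u + (l \in S) + (l == i)) <= \sum_l (cdeg c u l + 1).
  apply: leq_sum => l _; have [->|neq_li] := eqVneq l i.
    by have [-> _] := fullu j jS; rewrite inE; lia.
  by case: (boolP (l \in S)) => [/fullu[_ ->]|_]; [|have := lowu l]; lia.
rewrite !big_split /= sum_eq sum_mem !sumC sum_cdeg.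
by have := ltq u; have := largeq u; have := largeq v; nia.
Qed.

End Multigraph.

(** * Back to simple graphs *)

Lemma edge_ends (G : sgraph) (e : edge G) (x : G) : x \in sval e ->
  exists2 y, y != x & forall z, (z \in sval e) = (z == x) || (z == y).
Proof.
case: e => f /= /imsetP[[a b] /=]; rewrite inE /= => ab ->.
have neq_ab : a != b by apply: contraTneq ab => ->; rewrite adj_irrefl.
rewrite !inE => /orP[] /eqP->; [exists b|exists a] => //; rewrite 1?eq_sym //.
- by move=> z; rewrite !inE.
- by move=> z; rewrite !inE orbC.
Qed.

Lemma card_incident_edges (G : sgraph) (v : G) :
  #|[set e : edge G | v \in sval e]| = degree v.
Proof.
rewrite /degree.
have <- : #|[set [set v; w] | w in [set w | adj v w]]| = #|[set w | adj v w]|.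
  apply: card_in_imset => a b; rewrite !inE => va vb eq_ab.
  have: a \in [set v; b] by rewrite -eq_ab !inE eqxx orbT.
  by rewrite !inE => /orP[/eqP av|/eqP//]; rewrite av adj_irrefl in va.
rewrite -(card_imset _ val_inj); apply: eq_card => f; apply/imsetP/imsetP.
- case=> e; rewrite inE => ve ->; have [y neq_yv incE] := edge_ends ve.
  have ef : val e = [set v; y] by apply/setP => z; rewrite incE !inE.
  exists y => //; rewrite inE.
  have: val e \in edges G by apply: valP.
  case/imsetP=> -[a b] /=; rewrite inE /= => ab; rewrite ef => eq_vy.
  have: v \in [set a; b] by rewrite -eq_vy !inE eqxx.
  have: y \in [set a; b] by rewrite -eq_vy !inE eqxx orbT.
  rewrite !inE => /orP[]/eqP ey /orP[]/eqP ev; move: neq_yv;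
    by rewrite ey ev ?eqxx // adj_sym.
case=> w; rewrite inE => vw ->.
have ef : [set v; w] \in edges G by apply/imsetP; exists (v, w); rewrite ?inE.
by exists (exist _ [set v; w] ef : edge G); rewrite // inE /= !inE eqxx.
Qed.

Lemma min_degree_le (G : sgraph) (v : G) : min_degree G <= degree v.
Proof.
rewrite /min_degree; have: v \in index_enum G by rewrite mem_index_enum.
elim: (index_enum G) => // w r IHr; rewrite inE big_cons => /predU1P[<-|/IHr].
  exact: geq_minl.
exact: leq_trans (geq_minr _ _).
Qed.

Theorem theorem11 (n m k : nat) (n_pos : 0 < n) (m_lt : m < 2 ^ n)
    (k_def : k = 2 ^ n + m - 1) (k_ge2 : 2 <= k) (G : sgraph)
    (min_deg : (3%:R / 2%:R * k%:R ^+ 2 + 1 / 2%:R * k%:R * m%:R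
                + 1 / 2%:R * k%:R <= (min_degree G)%:R :> rat)%R) :
  exists c : edge G -> 'I_k.+1, majority_edge_colouring G k k.+1 c.
Proof.
have k_gt0 : 0 < k by lia.
have large_deg : k * (3 * k + 1) <= 2 * min_degree G.
  rewrite -(ler_nat rat) !natrM natrD natrM.
  have : (0 <= k%:R * m%:R :> rat)%R by rewrite -natrM ler0n.
  by move: min_deg; lra.
pose inc (v : G) (e : edge G) := v \in sval e.
have [||v|c cP] := @exists_bounded_colouring G (edge G) 'I_k.+1 inc
  (@edge_ends G) k => //; first by rewrite card_ord.
  have := min_degree_le v; rewrite -card_incident_edges -/(vdeg inc v) => le_d.
  (* With [d] the degree and [q = d %/ k], [k(3k + 1) <= 2d < 2(q + 1)k] gives [3k + 1 < 2q + 2],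
     hence [3k <= 2q]. *)
  have := ltn_ceil (vdeg inc v) k_gt0; nia.
exists c => i v; rewrite ler_pdivlMr ?ltr0n // -natrM ler_nat.
have := cP v i; rewrite leq_divRL // /vdeg card_incident_edges; exact.
Qed.
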